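(* Let $G$ be a finite group and $V$ a finite $G$-module. Let $1\neq g\in G$ be such that $(o(g),|V|)=1$, where $o(g)$ is the order of $g$. Write $A=\langle g\rangle$, $N=N_G(A)$ and $C=C_V(g)$. Then the following hold. (a) $$|\mathrm{Irr}_g(GV)|\leq\frac{(n(N,A)-1)\,n(C_G(A),C)}{(|A|-1)|C|}\max_{1\neq a\in A}\big(|N_G(\langle a\rangle)|\,|C_V(a)|\big).$$ (b) If $g$ is of prime order, then $$|\mathrm{Irr}_g(GV)|\leq|C_G(A)|\,n(C_G(A),C).$$ (c) There are subsets $X,Y\subseteq\mathrm{Irr}_g(GV)$ such that $\mathrm{Irr}_g(GV)$ is the disjoint union of $X$ and $Y$ and $$|X|\leq\frac{(n(N,A)-1)\,n(C_G(A),C)}{(|A|-1)|C|^2}\max_{1\neq a\in A}\big(|N_G(\langle a\rangle)|\,|C_V(a)|\big),$$ $$|Y|\leq\frac{(n(N,A)-1)\,(n(C_G(A),C)-1)}{(|A|-1)|C|}\max_{1\neq a\in A}\big(|N_G(\langle a\rangle)|\,|C_V(a)|\big).$$ (d) If $g$ is of prime order and $X,Y$ are as in (c), then $$|X|\leq\frac{|C_G(A)|\,n(C_G(A),C)}{|C|}\quad\text{and}\quad |Y|\leq|C_G(A)|\,(n(C_G(A),C)-1).$$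
   Context: A finite $G$-module is a finite abelian group on which $G$ acts by automorphisms (the action need not be faithful). $GV$ denotes the semidirect product of $V$ by $G$, with $G$ and $V$ regarded as subgroups; $\mathrm{Irr}(GV)$ is the set of its irreducible complex characters. $C_V(a)$ is the set of fixed points of $a\in G$ in $V$; $C_G(A)$ and $N_G(\cdot)$ are the usual centralizer and normalizer in $G$. If a group $H$ acts on a set $B$, $n(H,B)$ denotes the number of orbits of $H$ on $B$; here $N$ acts on $A$ by conjugation and $C_G(A)$ acts on $C=C_V(g)$ via the module action. Since $g$ centralizes $C_V(g)$, $\langle g\rangle\times C_V(g)$ is a subgroup of $GV$. Let $\rho_{\langle g\rangle}$ be the regular character of $\langle g\rangle$. $\mathrm{Irr}_g(GV)$ denotes the set of all $\chi\in\mathrm{Irr}(GV)$ such that $\chi|_{\langle g\rangle\times C_V(g)}$ cannot be written as $\rho_{\langle g\rangle}\times\psi$ for a character $\psi$ of $C_V(g)$. *)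

(* Defs.v *)
From HB Require Import structures.
From mathcomp Require Import all_boot all_order all_algebra.
From mathcomp Require Import all_fingroup all_solvable all_field all_character.
From mathcomp Require Import boolp.

Set Implicit Arguments.
Unset Strict Implicit.
Unset Printing Implicit Defensive.

Import GroupScope Order.TTheory GRing.Theory Num.Theory.

(* n(H, B); meaningful when H is contained in D and acts on B. *)
Definition n_orbits (aT : finGroupType) (D : {set aT}) (T : finType)
    (to : action D T) (H : {set aT}) (B : {set T}) : nat :=
  #|orbit to H @: B|.

Section SemidirectProduct.

(* A finite G-module is an abelian group V, written multiplicatively, with
   to : groupAction G V. *)
Variables (aT rT : finGroupType) (G : {group aT}) (V : {group rT}).
Variable to : groupAction G V.

Definition semidirect : {group sdprod_by to} := [set: sdprod_by to]%G.

(* <g> and C_V(g), regarded as subgroups of GV. *)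
Definition sd_cycle (g : aT) : {group sdprod_by to} :=
  (sdpair2 to @* <[g]>)%G.

Definition sd_cent (g : aT) : {group sdprod_by to} :=
  (sdpair1 to @* 'C_(V | to)[g])%G.

Lemma sd_cycle_cent_dprod (g : aT) : g \in G ->
  sd_cycle g \x sd_cent g = sd_cycle g <*> sd_cent g.
Proof.
move=> gG; apply: dprodEY => /=.
  by rewrite sub_morphim_pre ?subsetIl // -gacent_cycle // gacentEsd subsetIr.
apply/trivgP; rewrite -(im_sdpair_TI to) setIC setISS ?morphimS ?subsetIl //.
by rewrite cycle_subG.
Qed.

(* Irr_g(GV), as a set of indices of irreducible characters; cfDprod AxC phi
   psi is the character phi x psi of the internal direct product A x C. *)
Definition Irr_g (g : aT) (gG : g \in G) : {set Iirr semidirect} :=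
  [set i | `[< ~ exists2 psi : 'CF(sd_cent g), psi \is a character &
     ('Res[sd_cycle g <*> sd_cent g] 'chi[semidirect]_i)%R
       = cfDprod (sd_cycle_cent_dprod gG) (cfReg (sd_cycle g)) psi >]].

End SemidirectProduct.

(* Main.v *)
(* Write the restriction of chi to A x C as the sum of chi_j x mu_j over
   mu_j in Irr(C).  Then chi lies in Irr_g only if some chi_j is not a multiple
   of the regular character of A, and in that case the sum of |chi_j(a)|^2 over
   1 <> a in A is at least |A| - 1, because it is the sum of the squared
   differences of the multiplicities in chi_j.  By Parseval on C, the sum of
   |chi(ac)|^2 over 1 <> a and c is then at least (|A| - 1)|C|, while column
   orthogonality bounds the sum over all chi, since a and c have coprime orders.
   For (c), choose j so that the fewest chi have a chi_j that is not a multiple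
   of the regular character; comparison with the average over all j saves a
   factor |C|.  These chi in Irr_g form X, the others form Y.
   On Y the relation chi_j(a) = 0 is linear in the columns of the classes
   meeting aC, and it replaces the number of these classes by one less. *)

Require Import Defs.
From HB Require Import structures.
From mathcomp Require Import all_boot all_order all_algebra.
From mathcomp Require Import all_fingroup all_solvable all_field all_character.
From mathcomp Require Import boolp ring.

Set Implicit Arguments.
Unset Strict Implicit.
Unset Printing Implicit Defensive.

Import GroupScope Order.TTheory GRing.Theory Num.Theory.
Local Open Scope ring_scope.

(** * Two inequalities: integer variance and weighted Cauchy-Schwarz *)

Lemma nonconstant_int_variance (I : finType) (m : I -> algC) (i0 i1 : I) :
  (forall i, m i \is a Num.int) -> m i0 != m i1 ->
  #|I|%:R - 1 <= #|I|%:R * (\sum_i m i ^+ 2) - (\sum_i m i) ^+ 2.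
Proof.
move=> m_int ne01.
(* Summed over [i], the squared differences run over ordered pairs, so they give twice the
   right-hand side. *)
pose D i := \sum_j (m i - m j) ^+ 2.
have sumD : \sum_i D i
    = (#|I|%:R * (\sum_i m i ^+ 2) - (\sum_i m i) ^+ 2) *+ 2.
  have DE i : D i = #|I|%:R * m i ^+ 2 - (m i * \sum_j m j) *+ 2
                    + \sum_j m j ^+ 2.
    rewrite /D; under eq_bigr do rewrite sqrrB.
    by rewrite big_split sumrB /= sumr_const sumrMnl -mulr_sumr; ring.
  under eq_bigr do rewrite DE.
  rewrite big_split sumrB /= -mulr_sumr sumrMnl -mulr_suml sumr_const.
  by rewrite -(mulr_natl (\sum_j _ ^+ 2)); ring.
have ge1 i j : m i != m j -> 1 <= (m i - m j) ^+ 2.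
  by move=> ne; rewrite sqr_intr_ge1 ?subr_eq0 // rpredB.
have ge0 i j : 0 <= (m i - m j) ^+ 2.
  by rewrite real_exprn_even_ge0 // Rreal_int // rpredB.
have two j : 1 <= (m i0 - m j) ^+ 2 + (m i1 - m j) ^+ 2.
  have [<-|ne] := eqVneq (m i0) (m j).
    by rewrite ler_wpDl // ge1 // eq_sym.
  by rewrite ler_wpDr // ge1.
have i10 : i1 != i0 by apply: contraNneq ne01 => ->.
have cardI : #|I|%:R = 1 + (1 + \sum_(i | (i != i0) && (i != i1)) 1) :> algC.
  by rewrite -sumr_const (bigD1 i0) //= (bigD1 i1).
suff: (#|I|%:R - 1) *+ 2 <= \sum_i D i by rewrite sumD lerMn2r.
(* By [two], rows [i0] and [i1] together give at least [#|I|]; each of the other [#|I| - 2] rows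
   gives at least 1 from its columns [i0] and [i1]. *)
rewrite (bigD1 i0) //= (bigD1 i1) //= addrA -big_split /=.
have -> : (#|I|%:R - 1) *+ 2
          = #|I|%:R + \sum_(i | (i != i0) && (i != i1)) (1 : algC).
  by rewrite mulr2n {1}cardI; ring.
rewrite lerD //; first by rewrite -sumr_const ler_sum.
apply: ler_sum => i _; rewrite /D (bigD1 i0) //= (bigD1 i1) //= addrA.
rewrite ler_wpDr ?sumr_ge0 //.
by rewrite -[m i - m i0]opprB -[m i - m i1]opprB !sqrrN.
Qed.

(** Applied with [w] the centralizer orders, so that the last factor becomes a class weight. *)
Lemma weighted_Cauchy_Schwarz (J : finType) (P : {pred J})
    (w b x : J -> algC) : (forall k, k \in P -> 0 < w k) ->
  `|\sum_(k in P) b k * x k| ^+ 2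
    <= (\sum_(k in P) w k * `|b k| ^+ 2) * \sum_(k in P) `|x k| ^+ 2 / w k.
Proof.
move=> w_gt0; set s := \sum_(k in P) _; set B := \sum_(k in P) _.
set E := \sum_(k in P) _.
have B_ge0 : 0 <= B.
  by apply: sumr_ge0 => k /w_gt0/ltW w0; rewrite mulr_ge0 ?exprn_ge0.
have [B0|B_neq0] := eqVneq B 0.
  suff -> : s = 0 by rewrite normr0 expr0n B0 mul0r.
  apply: big1 => k kP; apply/eqP; rewrite mulf_eq0 -normr_eq0; apply/orP; left.
  have: w k * `|b k| ^+ 2 = 0.
    apply: (psumr_eq0P _ B0) => // i /w_gt0/ltW w0.
    by rewrite mulr_ge0 ?exprn_ge0.
  by move/eqP; rewrite mulf_eq0 gt_eqF ?w_gt0 //= expf_eq0.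
have B_gt0 : 0 < B by rewrite lt_def B_neq0.
have B_conj : B^* = B by rewrite conj_Creal // ger0_real.
rewrite -[leLHS](divfK B_neq0) mulrC ler_pM2l // -subr_ge0.
(* expand the squared distance from [x] to its projection on [b] *)
suff -> : E - `|s| ^+ 2 / B
    = \sum_(k in P) `|x k - s / B * (w k * (b k)^*)| ^+ 2 / w k.
  by apply: sumr_ge0 => k /w_gt0/ltW w0; rewrite divr_ge0 ?exprn_ge0.
have term k : k \in P -> `|x k - s / B * (w k * (b k)^*)| ^+ 2 / w k
    = `|x k| ^+ 2 / w k - s^* / B * (b k * x k) - s / B * (b k * x k)^*
      + s * s^* / B ^+ 2 * (w k * `|b k| ^+ 2).
  move=> /w_gt0 w0.
  have w_conj : (w k)^* = w k by rewrite conj_Creal // ger0_real // ltW.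
  rewrite !normCK !(rmorphB, rmorphM, fmorphV) /= conjCK w_conj B_conj.
  by field; rewrite B_neq0 gt_eqF.
rewrite (eq_bigr _ term) big_split /= !sumrB -!mulr_sumr -/B -/E -/s.
by rewrite -rmorph_sum -/s normCK; field.
Qed.

(** * Weights of characters on sets of conjugacy classes *)

Section ClassWeight.

Variables (gT : finGroupType) (S : {group gT}).

(** Dividing each column of the character table by the square root of the centralizer order makes
    the table unitary; this is the squared length of row [i] restricted to the columns in [P]. *)
Definition class_weight (i : Iirr S) (P : {set {set gT}}) : algC :=
  \sum_(K in P) `|'chi_i (repr K)| ^+ 2 / #|'C_S[repr K]|%:R.

Lemma cent1_natr_gt0 (x : gT) : 0 < #|'C_S[x]|%:R :> algC.
Proof. by rewrite ltr0n cardG_gt0. Qed.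

Lemma irr_classes_orthogonality (K M : {set gT}) :
    K \in classes S -> M \in classes S ->
  \sum_i 'chi[S]_i (repr K) * ('chi_i (repr M))^*
    = #|'C_S[repr K]|%:R *+ (K == M).
Proof.
case/repr_classesP=> _ KE /repr_classesP[MS ME].
rewrite second_orthogonality_relation //.
congr (_ *+ nat_of_bool _); rewrite [in RHS]ME {2}KE.
exact: sameP class_eqP eqP.
Qed.

Lemma sum_class_weight (P : {set {set gT}}) :
  P \subset classes S -> \sum_i class_weight i P = #|P|%:R.
Proof.
move/subsetP=> sPS; rewrite exchange_big /= -sumr_const.
apply: eq_bigr => K /sPS KS; rewrite -mulr_suml.
under eq_bigr do rewrite normCK.
by rewrite irr_classes_orthogonality // eqxx divff // gt_eqF ?cent1_natr_gt0.
Qed.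

(* A linear relation among the columns of the character table indexed by [P],
   valid on the rows in [Z], costs one dimension: by Bessel's inequality the
   rows outside [Z] carry weight at least 1. *)
Lemma sum_class_weight_relation (P : {set {set gT}}) (Z : {set Iirr S})
    (b : {set gT} -> algC) (K0 : {set gT}) :
    P \subset classes S -> K0 \in P -> b K0 != 0 ->
    (forall i, i \in Z -> \sum_(K in P) b K * 'chi_i (repr K) = 0) ->
  \sum_(i in Z) class_weight i P <= #|P|%:R - 1.
Proof.
move=> sPS K0P bK0 relZ; have sPSP := subsetP sPS.
pose w (K : {set gT}) : algC := #|'C_S[repr K]|%:R.
have w_gt0 K : 0 < w K by apply: cent1_natr_gt0.
pose u i := \sum_(K in P) b K * 'chi[S]_i (repr K).
pose B := \sum_(K in P) w K * `|b K| ^+ 2.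
have B_gt0 : 0 < B.
  rewrite /B (bigD1 K0) //= ltr_pwDl //.
    by rewrite mulr_gt0 ?w_gt0 // exprn_gt0 // normr_gt0.
  by apply: sumr_ge0 => K _; rewrite mulr_ge0 ?exprn_ge0 // ltW ?w_gt0.
have u_norm : \sum_i `|u i| ^+ 2 = B.
  transitivity (\sum_(K in P) \sum_(M in P) b K * (b M)^* *
                  \sum_i 'chi[S]_i (repr K) * ('chi_i (repr M))^*).
    transitivity (\sum_i \sum_(K in P) \sum_(M in P)
        b K * (b M)^* * ('chi[S]_i (repr K) * ('chi_i (repr M))^*)).
      apply: eq_bigr => i _; rewrite normCK rmorph_sum mulr_suml.
      apply: eq_bigr => K _; rewrite mulr_sumr; apply: eq_bigr => M _.
      by rewrite rmorphM mulrACA.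
    rewrite exchange_big; apply: eq_bigr => K _ /=.
    rewrite exchange_big; apply: eq_bigr => M _ /=.
    by rewrite mulr_sumr.
  apply: eq_bigr => K KP; rewrite (bigD1 K) //=.
  rewrite irr_classes_orthogonality ?sPSP // eqxx.
  rewrite big1 => [|M /andP[MP MK]]; first by rewrite addr0 normCK mulrC.
  by rewrite irr_classes_orthogonality ?sPSP // eq_sym (negPf MK) mulr0.
(* The weights of all rows add up to [#|P|]. *)
suff: 1 <= \sum_(i | i \notin Z) class_weight i P.
  rewrite -(sum_class_weight sPS) [\sum_i _](bigID (mem Z)) /=.
  by rewrite lerBrDr lerD2l.
(* The whole norm [B] of [u] comes from rows outside [Z], and Cauchy-Schwarz bounds each such entry
   by [B] times the weight of its row. *)
rewrite -(ler_pM2l B_gt0) mulr1 -{1}u_norm (bigID (mem Z)) /=.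
rewrite big1 ?add0r => [|i iZ]; last by rewrite /u relZ // normr0 expr0n.
rewrite mulr_sumr; apply: ler_sum => i _.
exact: weighted_Cauchy_Schwarz.
Qed.

End ClassWeight.

(** * Restriction to a coprime abelian direct product *)

Section DirectProductSubgroup.

Variables (gT : finGroupType) (S A C L : {group gT}).
Hypotheses (defL : A \x C = L) (sLS : L \subset S).
Hypotheses (abA : abelian A) (abC : abelian C) (coAC : coprime #|A| #|C|).

Definition dprod_mult (i : Iirr S) (j : Iirr C) (k : Iirr A) : algC :=
  '['Res[L] 'chi_i, cfDprod defL 'chi_k 'chi_j].

Definition dprod_part (i : Iirr S) (j : Iirr C) : 'CF(A) :=
  \sum_k dprod_mult i j k *: 'chi_k.

Lemma dprod_mult_nat i j k : dprod_mult i j k \is a Num.nat.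
Proof.
by rewrite Cnat_cfdot_char ?cfDprod_char ?irr_char // cfRes_char ?irr_char.
Qed.

Lemma dprod_part_sum i :
  'Res[L] 'chi[S]_i = \sum_j cfDprod defL (dprod_part i j) 'chi_j.
Proof.
rewrite [LHS]cfun_sum_cfdot (reindex (dprod_Iirr defL)) /=; last first.
  exists (inv_dprod_Iirr defL) => ? _; first exact: dprod_IirrK.
  exact: inv_dprod_IirrK.
rewrite -(pair_bigA _ (fun k j =>
  '['Res[L] 'chi_i, 'chi_(dprod_Iirr defL (k, j))]
    *: 'chi_(dprod_Iirr defL (k, j)))) /= exchange_big /=.
apply: eq_bigr => j _; rewrite /dprod_part /cfDprod !linear_sum /= mulr_suml.
apply: eq_bigr => k _; rewrite !dprod_IirrE /dprod_mult.
by rewrite linearZ /= -scalerAl.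
Qed.

Lemma dprod_partE i a c : a \in A -> c \in C ->
  'chi[S]_i (a * c)%g = \sum_j dprod_part i j a * 'chi_j c.
Proof.
move=> aA cC; have acL : (a * c)%g \in L.
  by have [_ <- _ _] := dprodP defL; rewrite mem_mulg.
rewrite -(cfResE _ sLS) // dprod_part_sum sum_cfunE.
by apply: eq_bigr => j _; rewrite cfDprodE.
Qed.

(** The function sending [c] to ['chi_i (a * c)], built from its Fourier expansion so that it is a
    class function by construction. Inversion and Parseval on [C] then follow from inner
    products. *)
Let slice i a : 'CF(C) := \sum_j dprod_part i j a *: 'chi_j.

Let sliceE i a c : a \in A -> c \in C -> slice i a c = 'chi[S]_i (a * c)%g.
Proof.
move=> aA cC; rewrite dprod_partE // sum_cfunE.
by apply: eq_bigr => j _; rewrite cfunE.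
Qed.

Let slice_dot i a j : '[slice i a, 'chi_j] = dprod_part i j a.
Proof.
rewrite cfdot_suml (bigD1 j) //= cfdotZl cfnorm_irr mulr1 big1 ?addr0 //.
by move=> k /negPf kj; rewrite cfdotZl cfdot_irr kj mulr0.
Qed.

Lemma card_natr_neq0 (H : {group gT}) : #|H|%:R != 0 :> algC.
Proof. by rewrite pnatr_eq0 -lt0n cardG_gt0. Qed.

Lemma dprod_part_transform i j a : a \in A ->
  dprod_part i j a
    = #|C|%:R^-1 * \sum_(c in C) 'chi[S]_i (a * c)%g * ('chi_j c)^*.
Proof.
move=> aA; rewrite -slice_dot cfdotE; congr (_ * _).
by apply: eq_bigr => c cC; rewrite sliceE.
Qed.

Lemma dprod_part_Parseval i a : a \in A ->
  \sum_(c in C) `|'chi[S]_i (a * c)%g| ^+ 2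
    = #|C|%:R * \sum_j `|dprod_part i j a| ^+ 2.
Proof.
move=> aA; transitivity (#|C|%:R * '[slice i a]).
  rewrite cfdotE mulVKf ?card_natr_neq0 //.
  by apply: eq_bigr => c cC; rewrite sliceE // normCK.
by rewrite cfdot_sum_irr; under eq_bigr do rewrite slice_dot -normCK.
Qed.

(* The ['chi_j]-component of the restriction is a multiple of [cfReg A]. *)
Definition dprod_flat (i : Iirr S) (j : Iirr C) :=
  [forall k, dprod_mult i j k == dprod_mult i j 0].

Lemma dprod_part_flat i j a : dprod_flat i j -> a \in A^#%g ->
  dprod_part i j a = 0.
Proof.
move/forallP=> flat /setD1P[a1 aA].
rewrite /dprod_part.
rewrite (eq_bigr (fun k => dprod_mult i j 0 *: 'chi[A]_k)); last first.
  by move=> k _; rewrite (eqP (flat k)).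
rewrite -scaler_sumr.
have -> : \sum_k 'chi[A]_k = cfReg A.
  rewrite cfReg_sum; apply: eq_bigr => k _.
  by rewrite lin_char1 ?scale1r //; apply/char_abelianP.
by rewrite cfunE cfRegE (negPf a1) mulr0.
Qed.

(** The variance bound applies to the [#|A|] multiplicities. Their sum is the value at 1, and by
    Parseval [#|A|] times the sum of their squares is the squared norm over all of [A]; the
    difference is the sum over [A^#]. *)
Lemma dprod_part_nonflat i j : ~~ dprod_flat i j ->
  #|A|%:R - 1 <= \sum_(a in A^#%g) `|dprod_part i j a| ^+ 2.
Proof.
case/forallPn => k ne.
have int_m k' : dprod_mult i j k' \is a Num.int.
  by rewrite intr_nat ?dprod_mult_nat.
have:= nonconstant_int_variance int_m ne.
rewrite card_Iirr_abelian // => /le_trans-> //.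
have -> : (\sum_k0 dprod_mult i j k0) ^+ 2 = `|dprod_part i j 1%g| ^+ 2.
  rewrite sum_cfunE; under [in RHS]eq_bigr do
    rewrite cfunE (lin_char1 (char_abelianP _ abA _)) mulr1.
  by rewrite ger0_norm ?sumr_ge0 // => ? _; rewrite natr_ge0 ?dprod_mult_nat.
have -> : #|A|%:R * (\sum_k0 dprod_mult i j k0 ^+ 2)
    = \sum_(a in A) `|dprod_part i j a| ^+ 2.
  transitivity (#|A|%:R * '[dprod_part i j]).
    rewrite cfdot_sum_irr; congr (_ * _); apply: eq_bigr => k' _.
    have -> : '[dprod_part i j, 'chi_k'] = dprod_mult i j k'.
      rewrite cfdot_suml (bigD1 k') //= cfdotZl cfnorm_irr mulr1 big1 ?addr0 //.
      by move=> l /negPf lk; rewrite cfdotZl cfdot_irr lk mulr0.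
    by rewrite expr2 conj_natr ?dprod_mult_nat.
  rewrite cfdotE mulVKf ?card_natr_neq0 //.
  by apply: eq_bigr => a _; rewrite normCK.
by rewrite (big_setD1 1%g) //= addrC addrK.
Qed.

Lemma dprod_flat_cfReg i : (forall j, dprod_flat i j) ->
  exists2 psi : 'CF(C), psi \is a character &
    'Res[L] 'chi[S]_i = cfDprod defL (cfReg A) psi.
Proof.
move=> flat; exists (\sum_j dprod_mult i j 0 *: 'chi_j).
  apply: rpred_sum => j _; case/natrP: (dprod_mult_nat i j 0) => n ->.
  by rewrite scaler_nat rpredMn ?irr_char.
rewrite dprod_part_sum /cfDprod linear_sum mulr_sumr /=.
apply: eq_bigr => j _.
rewrite [cfDprodr _ (_ *: _)]linearZ /= -scalerAr scalerAl -linearZ /=.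
congr (cfDprodl _ _ * _); rewrite cfReg_sum scaler_sumr.
apply: eq_bigr => k _; move/forallP/(_ k)/eqP: (flat j) => ->.
by rewrite (lin_char1 (char_abelianP _ abA _)) scale1r.
Qed.

Let commAC a c : a \in A -> c \in C -> commute a c.
Proof.
by have [_ _ /centsP cAC _] := dprodP defL => aA cC; apply/commute_sym/cAC.
Qed.

(** By coprimality [a] is the [\pi(A)]-part of [a * c], and taking this part commutes with
    conjugation. *)
Let conj_parts a c x a' c' : a \in A -> c \in C -> a' \in A -> c' \in C ->
  (a * c = (a' * c') ^ x)%g -> (a = a' ^ x)%g /\ (c = c' ^ x)%g.
Proof.
have part b d : b \in A -> d \in C -> ((b * d).`_\pi(A) = b)%g.
  move=> bA dC; rewrite consttM; last exact: commAC.
  rewrite constt_p_elt ?(mem_p_elt (pgroup_pi A)) //.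
  suff /constt1P-> : (\pi(A)^').-elt d by rewrite mulg1.
  by apply: (mem_p_elt _ dC); rewrite /pgroup -coprime_pi' ?cardG_gt0.
move=> aA cC a'A c'C E; have Ea : (a = a' ^ x)%g.
  by rewrite -(part a c) // E consttJ part.
by split=> //; apply: (mulgI a); rewrite E conjMg -Ea.
Qed.

Definition coset_classes (a : gT) : {set {set gT}} :=
  [set (a * c)%g ^: S | c in C].

Let memL a c : a \in A -> c \in C -> (a * c)%g \in S.
Proof.
by move=> aA cC; rewrite (subsetP sLS) //; have [_ <- _ _] := dprodP defL;
  rewrite mem_mulg.
Qed.

Lemma coset_classes_sub a : a \in A -> coset_classes a \subset classes S.
Proof.
move=> aA; apply/subsetP=> _ /imsetP[c cC ->].
by rewrite mem_classes ?memL.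
Qed.

Let cent1_fix (a x : gT) : (x \in 'C[a]) = (a ^ x == a)%g.
Proof.
by rewrite cent1C; apply/cent1P/eqP => [/commgP|] /conjg_fixP // /commgP.
Qed.

(** By [conj_parts], fusion inside the coset [aC] is already achieved by ['C_S[a]], and
    ['C_S[a * c]] centralizes both [a] and [c]. The bound is orbit-stabilizer for [c] under
    ['C_S[a]]. *)
Lemma card_coset_class a c : a \in A -> c \in C ->
  (#|[set d in C | (a * d)%g ^: S == (a * c)%g ^: S]| * #|'C_S[(a * c)%g]|
     <= #|'C_S[a]|)%N.
Proof.
move=> aA cC; pose H := 'C_S[a]%G.
have sH : [set d in C | (a * d)%g ^: S == (a * c)%g ^: S] \subset c ^: H.
  apply/subsetP=> d; rewrite inE => /andP[dC /eqP/class_eqP/imsetP[x xS E]].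
  have [Ea ->] := conj_parts aA dC aA cC E.
  by rewrite imset_f // in_setI xS cent1_fix -Ea eqxx.
have sC : 'C_S[(a * c)%g] \subset 'C_H[c].
  apply/subsetP=> x /setIP[xS]; rewrite cent1_fix => /eqP/esym E.
  have [Ea Ec] := conj_parts aA cC aA cC E.
  by rewrite !in_setI xS !cent1_fix -Ea -Ec !eqxx.
apply: leq_trans (leq_mul (subset_leq_card sH) (subset_leq_card sC)) _.
by rewrite -index_cent1 mulnC Lagrange ?subsetIl.
Qed.

Lemma sum_coset_norm_le i a : a \in A ->
  \sum_(c in C) `|'chi[S]_i (a * c)%g| ^+ 2
    <= #|'C_S[a]|%:R * class_weight i (coset_classes a).
Proof.
move=> aA; rewrite (partition_big_imset (fun c => (a * c)%g ^: S)) /=.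
rewrite mulr_sumr; apply: ler_sum => _ /imsetP[c cC ->].
set r := repr _.
have rE : r \in (a * c)%g ^: S := mem_repr _ (class_refl S (a * c)%g).
have -> : \sum_(d in C | (a * d)%g ^: S == (a * c)%g ^: S)
              `|'chi[S]_i (a * d)%g| ^+ 2
    = #|[set d in C | (a * d)%g ^: S == (a * c)%g ^: S]|%:R
      * `|'chi[S]_i r| ^+ 2.
  rewrite mulr_natl -sumr_const.
  apply: eq_big => [d|d /andP[dC /eqP Ed]]; first by rewrite inE.
  congr (`| _ | ^+ 2); move: rE; rewrite -Ed => /imsetP[x xS ->].
  by rewrite cfunJ.
rewrite [leRHS]mulrCA [leLHS]mulrC ler_wpM2l ?exprn_ge0 //.
rewrite ler_pdivlMr ?cent1_natr_gt0 //.
rewrite -natrM ler_nat; apply: leq_trans (card_coset_class aA cC).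
case/imsetP: rE => x xS ->.
by have -> : #|'C_S[(a * c) ^ x]| = #|'C_S[(a * c)%g]| by
  rewrite cent1J -{1}(conjGid xS) -conjIg cardJg.
Qed.

(** Flatness at [j] makes [dprod_part i j a] vanish. As a Fourier coefficient over [C], this is a
    linear relation among the columns of the classes meeting [aC]. *)
Lemma sum_flat_coset_weight j a : a \in A^#%g ->
  \sum_(i | dprod_flat i j) class_weight i (coset_classes a)
    <= #|coset_classes a|%:R - 1.
Proof.
move=> aA1; have [_ aA] := setD1P aA1.
pose b (K : {set gT}) := \sum_(c in C | (a * c)%g ^: S == K) ('chi_j c)^*.
have:= @sum_class_weight_relation _ S (coset_classes a)
  [set i | dprod_flat i j] b (a ^: S) (coset_classes_sub aA).
under eq_bigl do rewrite inE; apply.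
- by apply/imsetP; exists 1%g; rewrite ?mulg1 // group1.
(* The relation is nontrivial: only [c = 1] makes [a * c] conjugate to [a], so the class of [a] has
   coefficient 1. *)
- rewrite /b (big_pred1 1%g) => [|c /=].
    by rewrite (lin_char1 (char_abelianP _ abC _)) rmorph1 oner_eq0.
  apply/andP/eqP => [[cC /eqP/class_eqP/imsetP[x _ E]]|->].
    have := @conj_parts a c x a 1%g aA cC aA (group1 C).
    by rewrite mulg1 => /(_ E)[_ ->]; rewrite conj1g.
  by rewrite group1 mulg1 eqxx.
move=> i; rewrite inE => flat.
have := dprod_part_flat flat aA1; rewrite dprod_part_transform //.
move/eqP; rewrite mulf_eq0 invr_eq0 (negPf (card_natr_neq0 _)) /= => /eqP.
rewrite (partition_big_imset (fun c => (a * c)%g ^: S)) /= => E0.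
rewrite -[RHS]E0; apply: eq_bigr => K KP; rewrite mulr_suml.
apply: eq_bigr => c /andP[cC /eqP cK]; rewrite mulrC; congr (_ * _).
have: repr K \in (a * c)%g ^: S.
  by rewrite -cK (mem_repr _ (class_refl S _)).
by case/imsetP=> x xS ->; rewrite cfunJ.
Qed.

(** * Counting characters with a nonflat component *)

Section Counting.

Variable n : nat.
Hypothesis coset_classes_le :
  forall a, a \in A^#%g -> (#|coset_classes a| <= n)%N.

Let D := (\sum_(a in A^#%g) #|'C_S[a]|)%N.

Let sumA1 a : a \in A^#%g -> a \in A. Proof. by case/setD1P. Qed.

Let sum_norm_ge i j : ~~ dprod_flat i j ->
  (#|A|.-1 * #|C|)%:R
    <= \sum_(a in A^#%g) \sum_(c in C) `|'chi[S]_i (a * c)%g| ^+ 2.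
Proof.
move=> nf; under eq_bigr => a /sumA1 aA do rewrite dprod_part_Parseval //.
rewrite -mulr_sumr natrM mulrC ler_pM2l ?ltr0n ?cardG_gt0 //.
rewrite exchange_big (bigD1 j) //= ler_wpDr //.
  by apply: sumr_ge0 => ? _; apply: sumr_ge0 => ? _; rewrite exprn_ge0.
by rewrite -subn1 natrB ?cardG_gt0 // dprod_part_nonflat.
Qed.

Let weight_ge0 (i : Iirr S) a : 0 <= class_weight i (coset_classes a).
Proof. by apply: sumr_ge0 => K _; rewrite divr_ge0 ?exprn_ge0 // ler0n. Qed.

Let sum_norm_le (T : {set Iirr S}) r :
    (forall a, a \in A^#%g ->
       \sum_(i in T) class_weight i (coset_classes a) <= r%:R) ->
  \sum_(i in T) \sum_(a in A^#%g) \sum_(c in C) `|'chi[S]_i (a * c)%g| ^+ 2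
    <= (D * r)%:R.
Proof.
move=> le_r; rewrite exchange_big natrM natr_sum mulr_suml /=.
apply: ler_sum => a aA1.
apply: le_trans (_ : \sum_(i in T) #|'C_S[a]|%:R *
                       class_weight i (coset_classes a) <= _).
  by apply: ler_sum => i _; apply: sum_coset_norm_le; apply: sumA1.
by rewrite -mulr_sumr ler_pM2l ?cent1_natr_gt0 // le_r.
Qed.

Let sum_weight_le (T : {set Iirr S}) a : a \in A^#%g ->
  \sum_(i in T) class_weight i (coset_classes a) <= n%:R.
Proof.
move=> aA1; apply: le_trans (_ : #|coset_classes a|%:R <= _); last first.
  by rewrite ler_nat coset_classes_le.
rewrite -(sum_class_weight (coset_classes_sub (sumA1 aA1))).
by rewrite [leRHS](bigID (mem T)) /= lerDl sumr_ge0.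
Qed.

Lemma card_nonflat_le (T : {set Iirr S}) :
    (forall i, i \in T -> exists j, ~~ dprod_flat i j) ->
  (#|T| * (#|A|.-1 * #|C|) <= D * n)%N.
Proof.
move=> nfT; rewrite -(ler_nat algC) natrM mulr_natl -sumr_const.
apply: le_trans (_ : \sum_(i in T) \sum_(a in A^#%g) \sum_(c in C)
                        `|'chi[S]_i (a * c)%g| ^+ 2 <= _).
  by apply: ler_sum => i /nfT[j]; apply: sum_norm_ge.
exact: sum_norm_le (sum_weight_le T).
Qed.

Lemma card_nonflat_at_le : exists j,
  (#|[set i | ~~ dprod_flat i j]| * (#|A|.-1 * #|C| ^ 2) <= D * n)%N.
Proof.
pose U j : nat := (#|[set i | ~~ dprod_flat i j]| * #|A|.-1)%N.
(* The index [0] only witnesses nonemptiness. The minimum is at most the average over the [#|C|]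
   characters of [C]. *)
have [j _ minj] := @arg_minnP _ (0 : Iirr C) predT U isT.
exists j; rewrite mulnA -/(U j) expnS expn1 mulnCA (mulnC (U j)).
have : (#|C| * U j <= \sum_j' U j')%N.
  rewrite -(card_Iirr_abelian abC) -sum_nat_const.
  by apply: leq_sum => j' _; apply: minj.
move=> le1; rewrite -(ler_nat algC).
suff: (#|C| * \sum_j' U j')%N%:R <= (D * n)%:R :> algC.
  by apply: le_trans; rewrite ler_nat leq_mul2l le1 orbT.
apply: le_trans (_ : \sum_i \sum_(a in A^#%g) \sum_(c in C)
                        `|'chi[S]_i (a * c)%g| ^+ 2 <= _); last first.
  have := sum_norm_le (sum_weight_le setT).
  by under eq_bigl do rewrite inE.
(* All terms of Parseval are kept, so every nonflat pair of a character of [S] and one of [C]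
   contributes at least [#|A| - 1]. *)
under [leRHS]eq_bigr => i _ do under eq_bigr => a /sumA1 aA do
  rewrite dprod_part_Parseval //.
under [leRHS]eq_bigr => i _ do rewrite -mulr_sumr exchange_big /=.
rewrite -mulr_sumr natrM ler_pM2l ?ltr0n ?cardG_gt0 // exchange_big /=.
rewrite natr_sum; apply: ler_sum => k _.
rewrite natrM mulr_natl -sumr_const big_mkcond [leLHS]big_mkcond /=.
apply: ler_sum => i _; rewrite inE; case: ifPn => [nf|_].
  by rewrite -subn1 natrB ?cardG_gt0 // dprod_part_nonflat.
by apply: sumr_ge0 => ? _; rewrite exprn_ge0.
Qed.

Lemma card_flat_at_le (j : Iirr C) (T : {set Iirr S}) :
    (forall i, i \in T -> dprod_flat i j /\ exists k, ~~ dprod_flat i k) ->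
  (#|T| * (#|A|.-1 * #|C|) <= D * n.-1)%N.
Proof.
move=> flatT; rewrite -(ler_nat algC) natrM mulr_natl -sumr_const.
apply: le_trans (_ : \sum_(i in T) \sum_(a in A^#%g) \sum_(c in C)
                        `|'chi[S]_i (a * c)%g| ^+ 2 <= _).
  by apply: ler_sum => i /flatT[_ [k]]; apply: sum_norm_ge.
apply: sum_norm_le => a aA1.
apply: le_trans (_ : #|coset_classes a|%:R - 1 <= _); last first.
  (* Positivity makes the truncated subtraction in [n.-1] agree with the one in [algC]. *)
  have c_gt0 : (0 < #|coset_classes a|)%N.
    by apply/card_gt0P; exists ((a * 1)%g ^: S); apply/imsetP; exists 1%g.
  rewrite -[1]/(1%:R) -natrB // ler_nat -subn1.
  by rewrite leq_sub2r ?coset_classes_le.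
apply: le_trans (sum_flat_coset_weight j aA1).
rewrite big_mkcond [leRHS]big_mkcond /=; apply: ler_sum => i _.
by case: ifP => [/flatT[-> _] //|_]; case: ifP.
Qed.

End Counting.

End DirectProductSubgroup.

(** * Orbit counts and normalizers of cyclic subgroups *)

Lemma sum_orbits_le (aT : finGroupType) (D : {group aT}) (rT : finType)
    (to : action D rT) (H : {group aT}) (B : {set rT}) (f : rT -> nat)
    (m : nat) :
    (forall x, x \in B -> (f x * #|orbit to H x| <= m)%N) ->
  (\sum_(x in B) f x <= n_orbits to H B * m)%N.
Proof.
move=> le_m; rewrite (partition_big_imset (orbit to H)) /= -sum_nat_const.
apply: leq_sum => _ /imsetP[y yB ->]; set O := orbit to H y.
have O_gt0 : (0 < #|O|)%N by apply/card_gt0P; exists y; apply: orbit_refl.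
rewrite -(leq_pmul2r O_gt0) big_distrl /=.
apply: (@leq_trans (\sum_(x in B | orbit to H x == O) m)).
  by apply: leq_sum => x /andP[xB /eqP <-]; apply: le_m.
rewrite sum_nat_const mulnC leq_mul2l; apply/orP; right.
apply/subset_leq_card/subsetP=> x /andP[_ /eqP <-]; exact: orbit_refl.
Qed.

(** The identity is an orbit by itself; this is the source of the factor [nA - 1]. *)
Lemma n_orbitsJ_D1 (aT : finGroupType) (H K : {group aT}) :
  n_orbits 'J H K = (n_orbits 'J H K^#).+1.
Proof.
rewrite /n_orbits -{1}(setD1K (group1 K)) imsetU1 cardsU1 orbitJ class1G.
suff -> : 1%g \notin orbit 'J H @: K^# by [].
apply/imsetP=> -[x /setD1P[x1 _] E].
have: x \in orbit 'J H x by apply: orbit_refl.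
by rewrite -E => /set1P; apply/eqP.
Qed.

Section NormalizerOrbits.

Variables (aT : finGroupType) (G : {group aT}) (g : aT).

Let A := <[g]>%g.
Let N := 'N_G(A)%G.

Lemma norm_cycle_sub a : a \in A -> N \subset 'N_G(<[a]>)%g.
Proof.
move=> aA; rewrite subsetI subsetIl /=.
apply: char_norm_trans (subsetIr _ _).
by apply: cycle_subgroup_char; rewrite cycle_subG.
Qed.

(** Subgroups of a cyclic group are characteristic, so the [N]-orbit of [a] lies in its class under
    ['N_G(<[a]>)], which contains ['C_G[a]]. Orbit-stabilizer there bounds the contribution of each
    orbit. *)
Lemma sum_cent1_le (v : aT -> nat) :
  (\sum_(a in A^#%g) #|'C_G[a]%g| * v a
     <= (n_orbits 'J N A).-1
        * \max_(a in A^#%g) (#|'N_G(<[a]>)%g| * v a))%N.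
Proof.
rewrite n_orbitsJ_D1 /=; apply: sum_orbits_le => a aA1.
have [_ aA] := setD1P aA1.
apply: leq_trans (@leq_bigmax_cond _ _
  (fun a => (#|'N_G(<[a]>)%g| * v a)%N) a aA1).
rewrite mulnAC leq_mul2r; apply/orP; right; rewrite orbitJ.
apply: (@leq_trans (#|'C_('N_G(<[a]>))[a]%g| * #|a ^: 'N_G(<[a]>)|)%N).
  apply: leq_mul; apply: subset_leq_card; last first.
    by rewrite imsetS ?norm_cycle_sub.
  by rewrite -setIA setIS // subsetI subxx -cent_cycle cent_sub.
by rewrite -index_cent1 Lagrange ?subsetIl.
Qed.

Lemma cycle_prime_eq a : prime #[g] -> a \in A^#%g -> <[a]>%g = A.
Proof.
move=> pr_g /setD1P[a1 aA]; apply/eqP; rewrite eqEcard cycle_subG aA /=.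
have: (#[a] %| #[g])%N by apply: order_dvdG.
have a_neq1 : #[a] != 1%N by rewrite order_eq1.
by move/(prime_nt_dvdP pr_g a_neq1); rewrite /order => ->.
Qed.

(** Each nonidentity [a] generates [A], so its stabilizer in [N] is ['C_G(A)] and all orbits on
    [A^#] have the same length. *)
Lemma n_orbitsJ_prime : prime #[g] ->
  ((n_orbits 'J N A).-1 * #|N| = #|A|.-1 * #|'C_G(A)%g|)%N.
Proof.
move=> pr_g; rewrite n_orbitsJ_D1 /=.
have part : partition (orbit 'J N @: A^#%g) A^#%g.
  apply: orbit_partition; apply/actsP => x xN a /=.
  apply: memJ_norm; rewrite normD1.
  by case/setIP: xN.
have sCN : 'C_G(A)%g \subset N by rewrite setIS ?cent_sub.
have orb (B : {set aT}) : B \in orbit 'J N @: A^#%g -> #|B| = #|N : 'C_G(A)|%g.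
  case/imsetP=> a aA1 ->; rewrite orbitJ -index_cent1 -cent_cycle.
  by rewrite (cycle_prime_eq pr_g aA1) -setIA (setIidPr (cent_sub _)).
have := card_uniform_partition orb part.
rewrite -(Lagrange sCN) (cardsD1 1%g A) group1 /= => ->.
by rewrite mulnA mulnAC.
Qed.

End NormalizerOrbits.

(** * Centralizers and classes in the semidirect product *)

Section SemidirectCentralizers.

Variables (aT rT : finGroupType) (G : {group aT}) (V : {group rT}).
Variable to : groupAction G V.

Let S : {group sdprod_by to} := semidirect to.

Lemma sdpair1_gacent1 a : a \in G ->
  (sdpair1 to @* 'C_(V | to)[a] = 'C_(sdpair1 to @* V)[sdpair2 to a])%g.
Proof.
move=> aG; rewrite gacentEsd morphim_set1 // setIC cent_set1.
by rewrite setIC morphim_setIpre.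
Qed.

(** Conjugation by an element of the complement normalizes both factors, so its centralizer is the
    semidirect product of its centralizers in them. *)
Lemma card_cent1_sdpair2 a : a \in G ->
  (#|'C_S[sdpair2 to a]%g| = #|'C_G[a]%g| * #|'C_(V | to)[a]%g|)%N.
Proof.
move=> aG; have defS := sdprod_sdpair to.
have sN : [set sdpair2 to a] \subset 'N_('N(sdpair1 to @* V))(sdpair2 to @* G).
  rewrite sub1set; have [_ _ nVG _] := sdprodP defS.
  have aG' : sdpair2 to a \in (sdpair2 to @* G)%g by rewrite mem_morphim.
  by rewrite in_setI (subsetP nVG) // (subsetP (normG _)).
have := subcent_sdprod defS sN; rewrite cent_set1 => /sdprod_card <-.
rewrite -sdpair1_gacent1 // -injm_subcent1 ?injm_sdpair2 //.
by rewrite !card_injm ?injm_sdpair1 ?injm_sdpair2 ?subsetIl // mulnC.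
Qed.

Variable g : aT.
Hypothesis gG : g \in G.

Let A := <[g]>%g.
Let C := 'C_(V | to)[g]%g.

Lemma sd_cycle_D1_sum (f : sdprod_by to -> nat) :
  (\sum_(b in (sd_cycle to g)^#%g) f b = \sum_(a in A^#%g) f (sdpair2 to a))%N.
Proof.
have sAG : A^#%g \subset G.
  by apply: subset_trans (subsetDl _ _) _; rewrite cycle_subG.
rewrite /sd_cycle /= -injmD1 ?injm_sdpair2 // morphimEsub // big_imset //.
by move=> a b aA bA; apply: (injmP (injm_sdpair2 to)); apply: (subsetP sAG).
Qed.

(** Conjugation by ['C_G(A)] fixes [b] and moves [c] along its orbit, so the class of [b * c]
    depends only on that orbit. *)
Lemma coset_classes_orbits b : b \in sd_cycle to g ->
  (#|coset_classes S (sd_cent to g) b| <= n_orbits to 'C_G(A) C)%N.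
Proof.
case/morphimP=> a aG aA ->; set b' := sdpair2 to a.
pose F (B : {set rT}) := (b' * sdpair1 to (repr B))%g ^: S.
apply: leq_trans (leq_imset_card F _); apply: subset_leq_card.
apply/subsetP=> _ /imsetP[_ /morphimP[c cV cC ->] ->].
apply/imsetP; exists (orbit to 'C_G(A) c); first exact: imset_f.
have /orbitP[x xC E] : repr (orbit to 'C_G(A) c) \in orbit to 'C_G(A) c.
  exact: mem_repr (orbit_refl _ _ _).
have [xG xA] := setIP xC.
rewrite /F -E sdpair_act //; apply/class_eqP.
have -> : (b' * sdpair1 to c ^ sdpair2 to x)%g
          = ((b' * sdpair1 to c) ^ sdpair2 to x)%g.
  rewrite conjMg; congr (_ * _)%g; apply/esym/conjg_fixP/commgP.
  by rewrite /commute -!morphM //; congr (sdpair2 to _); apply/esym/(centP xA).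
by rewrite class_sym imset_f // inE.
Qed.

End SemidirectCentralizers.

Theorem theorem4p1 (aT rT : finGroupType) (G : {group aT}) (V : {group rT})
    (to : groupAction G V) (abV : abelian V)
    (g : aT) (gG : g \in G) (g_neq1 : g != 1%g) (coGV : coprime #[g] #|V|) :
  let A := <[g]>%g in
  let N := 'N_G(A)%g in
  let C := 'C_(V | to)[g]%g in
  let IrrgGV := Irr_g to gG in
  let nA : rat := (n_orbits 'J N A)%:R in
  let nC : rat := (n_orbits to 'C_G(A)%g C)%:R in
  let cardA : rat := #|A|%:R in
  let cardC : rat := #|C|%:R in
  let cardCGA : rat := #|'C_G(A)%g|%:R in
  let M : rat :=
    (\max_(a in A^#%g) (#|'N_G(<[a]>)%g| * #|'C_(V | to)[a]%g|)%N)%:R in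
  let is_decomposition (X Y : {set Iirr (semidirect to)}) : Prop :=
    [/\ X :|: Y = IrrgGV, [disjoint X & Y],
        #|X|%:R <= (nA - 1) * nC / ((cardA - 1) * cardC ^+ 2) * M &
        #|Y|%:R <= (nA - 1) * (nC - 1) / ((cardA - 1) * cardC) * M] in
  [/\ (* (a) *)
      #|IrrgGV|%:R <= (nA - 1) * nC / ((cardA - 1) * cardC) * M,
      (* (b) *)
      prime #[g] -> #|IrrgGV|%:R <= cardCGA * nC,
      (* (c) *)
      exists X Y : {set Iirr (semidirect to)}, is_decomposition X Y
    & (* (d) *)
      prime #[g] -> forall X Y : {set Iirr (semidirect to)},
        is_decomposition X Y ->
        #|X|%:R <= cardCGA * nC / cardC /\ #|Y|%:R <= cardCGA * (nC - 1)].
Proof.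
move=> A N C IrrgGV nA nC cardA cardC cardCGA M is_decomposition.
pose S := semidirect to; pose A' := sd_cycle to g; pose C' := sd_cent to g.
pose L := (A' <*> C')%G; pose defL : A' \x C' = L := sd_cycle_cent_dprod to gG.
have sLS : L \subset S by apply: subsetT.
have abA' : abelian A' by rewrite morphim_abelian ?cycle_abelian.
have abC' : abelian C'.
  by rewrite morphim_abelian // (abelianS _ abV) // subsetIl.
have oA' : #|A'| = #|A| by rewrite card_injm ?injm_sdpair2 ?cycle_subG.
have oC' : #|C'| = #|C| by rewrite card_injm ?injm_sdpair1 ?subsetIl.
have coAC' : coprime #|A'| #|C'|.
  by rewrite oA' oC' (coprime_dvdr _ coGV) // cardSg ?subsetIl.
pose n := n_orbits to 'C_G(A)%g C.
have cosets_le b : b \in A'^#%g -> (#|coset_classes S C' b| <= n)%N.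
  by case/setD1P=> _; apply: coset_classes_orbits.
pose m := (\max_(a in A^#%g) (#|'N_G(<[a]>)%g| * #|'C_(V | to)[a]%g|))%N.
pose k := (n_orbits 'J N A).-1.
have sum_le : (\sum_(b in A'^#%g) #|'C_S[b]%g| <= k * m)%N.
  rewrite sd_cycle_D1_sum //; apply: leq_trans (sum_cent1_le G g _).
  apply: leq_sum => a /setD1P[_ aA].
  by rewrite card_cent1_sdpair2 // (subsetP _ a aA) ?cycle_subG.
(* If every component were flat, the restriction would be the regular character times a character of
   [C]. *)
have nonflat i : i \in IrrgGV -> exists j, ~~ dprod_flat defL i j.
  rewrite inE => /asboolP nreg; apply/existsP; apply: contra_notT nreg.
  rewrite negb_exists => /forallP flat.
  by apply: dprod_flat_cfReg => // j; have := flat j; rewrite negbK.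
have p_gt0 : (0 < #|A|.-1)%N.
  by have := order_gt1 g; rewrite g_neq1 /order -/A; case: #|A| => [|[]].
have c_gt0 : (0 < #|C|)%N by apply: cardG_gt0.
have nAE : nA - 1 = k%:R.
  by rewrite /k -subn1 natrB // (n_orbitsJ_D1 N <[g]>%G).
have nCE : nC - 1 = n.-1%:R.
  rewrite -subn1 natrB // card_gt0; apply/set0Pn.
  by exists (orbit to 'C_G(A) 1%g); rewrite imset_f // group1.
have cardAE : cardA - 1 = #|A|.-1%:R by rewrite -subn1 natrB ?cardG_gt0.
have bound (x u v d : nat) : (0 < d)%N -> (x * d <= u * m * v)%N ->
    x%:R <= u%:R * v%:R / d%:R * M.
  move=> d_gt0 le; rewrite mulrAC ler_pdivlMr ?ltr0n //.
  by rewrite -!natrM ler_nat mulnAC.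
have boundA : #|IrrgGV|%:R <= (nA - 1) * nC / ((cardA - 1) * cardC) * M.
  rewrite nAE cardAE -(natrM _ #|A|.-1 #|C|).
  apply: (@bound _ k n); rewrite ?muln_gt0 ?p_gt0 //.
  rewrite -oA' -oC'.
  apply: leq_trans (card_nonflat_le sLS abA' coAC' cosets_le nonflat) _.
  by rewrite leq_mul2r sum_le orbT.
(* For prime order every [a] in the maximum generates [A], so [m] is at most [#|N| * #|C|], and
   [n_orbitsJ_prime] evaluates [k * #|N|]. *)
have prime_bound : prime #[g] -> (k * m <= #|A|.-1 * (#|'C_G(A)%g| * #|C|))%N.
  move=> pr_g; rewrite mulnA -n_orbitsJ_prime // -mulnA leq_mul2l.
  apply/orP; right; apply/bigmax_leqP=> a aA1.
  rewrite (cycle_prime_eq pr_g aA1) leq_mul2l; apply/orP; right.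
  have aG : a \in G by case/setD1P: aA1 => _; apply/subsetP; rewrite cycle_subG.
  by rewrite -(gacent_cycle to aG) (cycle_prime_eq pr_g aA1) gacent_cycle.
(* Kept general in [v] to serve (b) with [nC] and (d) with [nC / cardC] and [nC - 1]. *)
have prime_le (x v : rat) : prime #[g] -> 0 <= v ->
    x <= (nA - 1) * v / ((cardA - 1) * cardC) * M -> x <= cardCGA * v.
  move=> pr_g v_ge0 /le_trans-> //; rewrite nAE cardAE.
  rewrite -(natrM _ #|A|.-1 #|C|) mulrAC.
  rewrite ler_pdivrMr ?ltr0n ?muln_gt0 ?p_gt0 // mulrAC [leRHS]mulrAC.
  rewrite ler_wpM2r // -!natrM ler_nat mulnCA; exact: prime_bound.
split=> //.
- by move=> pr_g; apply: prime_le.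
- have [j le_j] := card_nonflat_at_le defL sLS abA' abC' coAC' cosets_le.
  pose Z : {set Iirr S} := [set i | ~~ dprod_flat defL i j].
  exists (IrrgGV :&: Z), (IrrgGV :\: Z); split.
  + exact: setID.
  + rewrite -setI_eq0; apply/eqP/setP=> i.
    by rewrite !in_setI in_setD in_set0; case: (i \in Z); rewrite ?andbF.
  + rewrite nAE cardAE -natrX -(natrM _ #|A|.-1 (#|C| ^ 2)).
    apply: (@bound _ k n).
      by rewrite muln_gt0 p_gt0 expn_gt0 c_gt0.
    rewrite -oA' -oC'.
    apply: (@leq_trans ((\sum_(b in A'^#%g) #|'C_S[b]%g|) * n)); last first.
      by rewrite leq_mul2r sum_le orbT.
    apply: leq_trans le_j; rewrite leq_mul2r subset_leq_card ?orbT //.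
    exact: subsetIr.
  rewrite nAE nCE cardAE -(natrM _ #|A|.-1 #|C|).
  apply: (@bound _ k n.-1); rewrite ?muln_gt0 ?p_gt0 //.
  rewrite -oA' -oC'.
  apply: (@leq_trans ((\sum_(b in A'^#%g) #|'C_S[b]%g|) * n.-1)); last first.
    by rewrite leq_mul2r sum_le orbT.
  apply: (card_flat_at_le sLS abA' abC' coAC' cosets_le (j := j)) => i.
  by rewrite 2!inE negbK => /andP[flat iI]; split=> //; apply: nonflat.
move=> pr_g X Y [_ _ leX leY]; split; last first.
  by apply: prime_le leY; rewrite // nCE.
rewrite -mulrA; apply: prime_le => //; first by rewrite divr_ge0.
apply: le_trans leX _; rewrite le_eqVlt; apply/orP; left; apply/eqP.
by rewrite expr2 !invfM !mulrA; ring.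
Qed.
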